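(* Let $2\le k\le n-1$ and let $f\in L^1(S^{n-1})$. Put $\varphi^{+}=F_k^{+}f$ and $\varphi^{-}=F_k^{-}f$. Then $\varphi^{+}$ and $\varphi^{-}$ belong to the range of $F_k$ on even integrable functions, and $f$ is recovered from $\varphi^{\pm}$ by the formula $$f(\theta)=\begin{cases}2\,(F_k^{-1}\varphi^{+})(\theta) & \text{if } \theta\in S^{n-1}_{+},\\ 2\,(F_k^{-1}\varphi^{-})(\theta) & \text{if } \theta\in S^{n-1}_{-},\end{cases}$$ for almost all $\theta\in S^{n-1}$.
   Context: $S^{n-1}$ is the unit sphere in $\mathbb{R}^n$; $S^{n-1}_{\pm}=\{\theta=(\theta_1,\ldots,\theta_n)\in S^{n-1}:\ \pm\theta_n>0\}$ are its open hemispheres; $e_n=(0,\ldots,0,1)$. $G_{n,k}$ is the Grassmann manifold of all $k$-dimensional linear subspaces $\xi$ of $\mathbb{R}^n$, with its rotation-invariant measure. For $\xi\in G_{n,k}$, $d_\xi\theta$ denotes the (unnormalized) $(k-1)$-dimensional surface element on the sphere $S^{n-1}\cap\xi$. The Funk-type transform is $(F_kf)(\xi)=\int_{S^{n-1}\cap\xi}f(\theta)\,d_\xi\theta$, $\xi\in G_{n,k}$. For $f\in L^1(S^{n-1})$ it is defined for almost all $\xi$. It is a known fact that $F_k$ is injective on the space of even functions in $L^1(S^{n-1})$ (its kernel on $L^1(S^{n-1})$ consists of the odd functions). $F_k^{-1}$ denotes the inverse of $F_k$ restricted to even functions in $L^1(S^{n-1})$: if $\varphi=F_kg$ almost everywhere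 with $g\in L^1(S^{n-1})$ even, then $F_k^{-1}\varphi=g$. Functions are identified when equal almost everywhere. The hemispherical transforms are, for $\xi\in G_{n,k}$ not orthogonal to $e_n$ (i.e. $\xi\not\subset e_n^\perp$), $$(F_k^{\pm}f)(\xi)=\int_{S^{n-1}_{\pm}\cap\xi}f(\theta)\,d_\xi\theta .$$ *)

(* Defs.v *)
From HB Require Import structures.
From mathcomp Require Import all_boot all_order all_algebra.
From mathcomp Require Import all_classical all_reals all_analysis.
From mathcomp Require Import measurable_realfun.

Set Implicit Arguments.
Unset Strict Implicit.
Unset Printing Implicit Defensive.

Import Order.TTheory GRing.Theory Num.Theory.
Import numFieldNormedType.Exports.

Local Open Scope classical_set_scope.
Local Open Scope ring_scope.

(* Matrices (in particular row vectors, i.e. points of R^n) carry the product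
   sigma-algebra, the smallest one making the entries measurable. *)
Section matrix_measurable.
Context {d : measure_display} {T : measurableType d}.
Variables m n : nat.

Definition mx_cylinders : set (set 'M[T]_(m, n)) :=
  [set C | exists i j (B : set T),
    measurable B /\ C = [set A : 'M[T]_(m, n) | B (A i j)]].

Definition mx_display : measure_display -> measure_display.
Proof. exact. Qed.

Let mx0 : <<s mx_cylinders >> set0.
Proof. exact: sigma_algebra0. Qed.

Let mxC A : <<s mx_cylinders >> A -> <<s mx_cylinders >> (~` A).
Proof. exact: sigma_algebraC. Qed.

Let mx_bigcup (F : (set 'M[T]_(m, n))^nat) :
  (forall i, <<s mx_cylinders >> (F i)) ->
  <<s mx_cylinders >> (\bigcup_i (F i)).
Proof. exact: sigma_algebra_bigcup. Qed.

HB.instance Definition _ := @isMeasurable.Build (mx_display d)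
  'M[T]_(m, n) <<s mx_cylinders >> mx0 mxC mx_bigcup.

Lemma measurable_entry (i : 'I_m) (j : 'I_n) :
  measurable_fun [set: 'M[T]_(m, n)] (fun A : 'M[T]_(m, n) => A i j).
Proof.
move=> _ B mB; rewrite setTI; apply: sub_sigma_algebra.
by exists i, j, B.
Qed.

Lemma measurable_fun_mx d' (S : measurableType d') (f : S -> 'M[T]_(m, n)) :
  (forall i j, measurable_fun setT (fun x => f x i j)) -> measurable_fun setT f.
Proof.
move=> mf; apply: (@measurability _ _ _ _ _ _ mx_cylinders) => //.
move=> _ [_ [i [j [B [mB ->]]]] <-]; exact: mf.
Qed.

End matrix_measurable.

Lemma sigma_finite_prod d1 d2 (T1 : measurableType d1) (T2 : measurableType d2)
  (R : realType) (m1 : {sigma_finite_measure set T1 -> \bar R})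
  (m2 : {sigma_finite_measure set T2 -> \bar R}) :
  sigma_finite setT (m1 \x m2)%E.
Proof.
have /sigma_finiteP[F [TF ndF Foo]] := sigma_finiteT m1.
have /sigma_finiteP[G [TG ndG Goo]] := sigma_finiteT m2.
exists (fun n => F n `*` G n).
  rewrite -setXTT TF TG predeqE => -[x y]; split.
    move=> [/= [n _ Fnx] [k _ Gky]]; exists (maxn n k) => //; split.
      by move: x Fnx; exact/subsetPset/ndF/leq_maxl.
    by move: y Gky; exact/subsetPset/ndG/leq_maxr.
  by move=> [n _ []/= ? ?]; split; exists n.
move=> k; have [? ?] := Foo k; have [? ?] := Goo k.
split; first exact: measurableX.
by rewrite product_measure1E// lte_mul_pinfty// ge0_fin_numE.
Qed.

(* Lebesgue measure on R^(d+1) is the image of the product of the Lebesgue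
   measures on R and on R^d under (t, v) |-> (t, v_1, ..., v_d). *)
Section lebesgue_step.
Context {R : realType} (d : nat).
Variable mu : {sigma_finite_measure set 'rV[R]_d -> \bar R}.

Definition cons_rV (p : measurableTypeR R * 'rV[R]_d) : 'rV[R]_d.+1 :=
  \row_j oapp (p.2 0) p.1 (unlift ord0 j).

Definition uncons_rV (x : 'rV[R]_d.+1) : measurableTypeR R * 'rV[R]_d :=
  (x 0 ord0, \row_j x 0 (lift ord0 j)).

Lemma cons_rVK : cancel cons_rV uncons_rV.
Proof.
case=> t v; rewrite /cons_rV /uncons_rV /= mxE unlift_none; congr pair.
by apply/rowP => j; rewrite !mxE liftK.
Qed.

Lemma measurable_cons_rV : measurable_fun setT cons_rV.
Proof.
apply: measurable_fun_mx => i j.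
under eq_fun do rewrite mxE.
case: unliftP => [k _|_] /=; last exact: measurable_fst.
exact: (measurableT_comp (measurable_entry 0 k) measurable_snd).
Qed.

Lemma measurable_uncons_rV : measurable_fun setT uncons_rV.
Proof.
apply/measurable_fun_pairP; split; first exact: (measurable_entry 0 ord0).
apply: measurable_fun_mx => i j.
under eq_fun do rewrite mxE.
exact: measurable_entry.
Qed.

Definition lebesgue_step : set 'rV[R]_d.+1 -> \bar R :=
  pushforward (@lebesgue_measure R \x mu)%E cons_rV.

Let lebesgue_step_measure : {measure set 'rV[R]_d.+1 -> \bar R} :=
  measure_function_pushforward__canonical__measure_function_Measure
    (@lebesgue_measure R \x mu)%E measurable_cons_rV.

HB.instance Definition _ := Measure.copy lebesgue_step lebesgue_step_measure.

Let lebesgue_step_sigma_finite : sigma_finite setT lebesgue_step.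
Proof.
have [F UF mF] := sigma_finite_prod (@lebesgue_measure R) mu.
exists (fun i => uncons_rV @^-1` F i).
  by rewrite -preimage_bigcup -UF preimage_setT.
move=> i; have [mFi Fi] := mF i; split.
  by rewrite -[X in measurable X]setTI; exact: measurable_uncons_rV.
rewrite /lebesgue_step /pushforward -comp_preimage.
by have -> : uncons_rV \o cons_rV = id by apply/funext => p; exact: cons_rVK.
Qed.

HB.instance Definition _ :=
  Measure_isSigmaFinite.Build _ _ _ lebesgue_step lebesgue_step_sigma_finite.

End lebesgue_step.

Fixpoint lebesgue_rV (R : realType) (d : nat) :
    {sigma_finite_measure set 'rV[R]_d -> \bar R} :=
  match d with
  | 0 => dirac (0 : 'rV[R]_0)
  | d'.+1 => lebesgue_step (lebesgue_rV R d')
  end.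

Section sphere.
Context {R : realType}.
Variable d : nat.

(* The norm that the library puts on matrices is the sup norm. *)
Definition enorm (x : 'rV[R]_d) : R := Num.sqrt (\sum_i x 0 i ^+ 2).

Definition sphere : set 'rV[R]_d := [set x | enorm x = 1].

Definition sphere_proj (x : 'rV[R]_d) : 'rV[R]_d := (enorm x)^-1 *: x.

Definition punctured_ball : set 'rV[R]_d := [set x | 0 < enorm x <= 1].

Lemma enorm_ge0 x : 0 <= enorm x.
Proof. exact: sqrtr_ge0. Qed.

Lemma measurable_enorm : measurable_fun setT enorm.
Proof.
have -> : enorm = (@powR R ^~ 2^-1) \o (fun x => \sum_i x 0 i ^+ 2).
  apply/funext => x /=; rewrite powR12_sqrt//.
  by apply: sumr_ge0 => i _; exact: sqr_ge0.
apply: (measurableT_comp (measurable_powR _)).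
apply: measurable_sum => i.
by apply: (measurable_funX 2); exact: (measurable_entry 0 i).
Qed.

Lemma measurable_sphere_proj : measurable_fun setT sphere_proj.
Proof.
apply: measurable_fun_mx => i j.
have -> : (fun x => sphere_proj x i j)
    = (fun x => ((@powR R ^~ (-1)) \o enorm) x * x i j).
  by apply/funext => x; rewrite mxE /= powR_inv1// enorm_ge0.
apply: measurable_funM; last exact: measurable_entry.
exact: (measurableT_comp (measurable_powR _) measurable_enorm).
Qed.

Lemma measurable_punctured_ball : measurable punctured_ball.
Proof.
have -> : punctured_ball = enorm @^-1` `]0, 1].
  by apply/seteqP; split => x /=; rewrite in_itv.
by rewrite -[X in measurable X]setTI; exact: measurable_enorm.
Qed.

(* Polar coordinates, dx = r^(d-1) dr dtheta, give the surface measure of a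
   Borel subset E of the unit sphere of R^d:
   sigma(E) = d * lebesgue {t theta | 0 < t <= 1, theta in E}. *)
Definition surface_measure (E : set 'rV[R]_d) : \bar R :=
  (d%:R%:E * lebesgue_rV R d (sphere_proj @^-1` E `&` punctured_ball))%E.

Let surface_measure_measure : {measure set 'rV[R]_d -> \bar R} :=
  mscale (d%:R%:nng)
    (measure_function_pushforward__canonical__measure_function_Measure
      (mrestr (lebesgue_rV R d) measurable_punctured_ball)
      measurable_sphere_proj).

HB.instance Definition _ :=
  Measure.copy surface_measure surface_measure_measure.

End sphere.

Lemma enorm_mulmx (R : realType) n (u : 'rV[R]_n) :
  u *m u^T = (enorm u ^+ 2)%:M.
Proof.
rewrite [LHS]mx11_scalar mxE; congr _%:M; rewrite sqr_sqrtr.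
  by apply: eq_bigr => i _; rewrite mxE expr2.
by apply: sumr_ge0 => i _; exact: sqr_ge0.
Qed.

Lemma enorm_eq0 (R : realType) n (u : 'rV[R]_n) : (enorm u == 0) = (u == 0).
Proof.
rewrite /enorm sqrtr_eq0; apply/idP/eqP => [u0|->]; last first.
  by rewrite big1// => i _; rewrite mxE expr0n.
have /psumr_eq0P : \sum_i u 0 i ^+ 2 = 0.
  by apply/eqP; rewrite eq_le u0/=; apply: sumr_ge0 => i _; exact: sqr_ge0.
move=> u0'; apply/rowP => i; rewrite mxE; apply/eqP.
by rewrite -sqrf_eq0 u0'// => j _; exact: sqr_ge0.
Qed.

Lemma gram_schmidt (R : realType) n k (B : 'M[R]_(k, n)) : row_free B ->
  exists2 A : 'M[R]_(k, n), A *m A^T = 1%:M & (A :=: B)%MS.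
Proof.
elim: k B => [|k IHk] B freeB.
  by exists B => //; apply/matrixP => -[].
change ('M[R]_(1 + k, n)) in B.
change (exists2 A : 'M[R]_(1 + k, n), A *m A^T = 1%:M & (A :=: B)%MS).
rewrite -[B]vsubmxK in freeB *.
move: (usubmx B) (dsubmx B) freeB => b B' {B} freeB.
have [C0 BC0] := row_freeP freeB.
have [C [C' BC]] : exists (C : 'M[R]_(n, 1)) (C' : 'M[R]_(n, k)),
    col_mx b B' *m row_mx C C' = 1%:M.
  by exists (@lsubmx _ n 1 k C0), (@rsubmx _ n 1 k C0); rewrite hsubmxK.
move: BC; rewrite mul_col_row scalar_mx_block => /eq_block_mx[bC _ B'C B'C'].
have freeB' : row_free B' by apply/row_freeP; exists C'.
have [A' A'1 A'B'] := IHk B' freeB'.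
pose u : 'rV[R]_n := b - b *m A'^T *m A'.
have uA' : u *m A'^T = 0 by rewrite mulmxBl -!mulmxA A'1 mulmx1 subrr.
have u0 : u != 0.
  apply/eqP => /subr0_eq bE.
  have /submxP[D bD] : (b <= B')%MS by rewrite -A'B' bE submxMl.
  move: bC; rewrite bD -mulmxA B'C mulmx0 => /matrixP/(_ 0 0).
  by rewrite !mxE eqxx => /eqP; rewrite eq_sym oner_eq0.
pose A : 'M[R]_(1 + k, n) := col_mx ((enorm u)^-1 *: u) A'.
have A1 : A *m A^T = 1%:M.
  rewrite tr_col_mx mul_col_row (@scalar_mx_block _ 1 k); congr block_mx => //.
  - rewrite linearZ/= -scalemxAl -scalemxAr scalerA enorm_mulmx scale_scalar_mx.
    by rewrite -expr2 -exprMn mulVf ?enorm_eq0// expr1n.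
  - by rewrite -scalemxAl uA' scaler0.
  - by rewrite linearZ/= -scalemxAr -[A' *m _]trmxK trmx_mul trmxK uA' trmx0 scaler0.
exists A; first by rewrite -(@scalar_mx_block _ 1 k).
have freeA : row_free A by apply/row_freeP; exists A^T.
have AB : (A <= col_mx b B')%MS.
  have B'B : (B' <= col_mx b B')%MS by rewrite -addsmxE addsmxSr.
  rewrite col_mx_sub A'B' B'B andbT scalemx_sub// addmx_sub//.
    by rewrite -addsmxE addsmxSl.
  rewrite eqmx_opp (submx_trans _ B'B)// -A'B'.
  exact: submxMl.
have := mxrank_leqif_eq AB; rewrite /leqif => -[_].
by rewrite (eqnP freeA) (eqnP freeB) eqxx => /esym/eqmxP.
Qed.

Section linear_subspaces.
Context {R : realType} {n : nat}.

HB.instance Definition _ := isPointed.Build {vspace 'rV[R]_n} 0%VS.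

Definition orthonormal_frame k (xi : {vspace 'rV[R]_n}) (A : 'M[R]_(k, n)) :=
  A *m A^T = 1%:M /\ forall x : 'rV[R]_n, (x \in xi) = (x <= A)%MS.

Definition frame k (xi : {vspace 'rV[R]_n}) : 'M[R]_(k, n) :=
  xget 0 [set A | orthonormal_frame xi A].

Lemma frameP k (xi : {vspace 'rV[R]_n}) :
  \dim xi = k -> orthonormal_frame xi (frame k xi).
Proof.
move=> <-{k}; apply: (@xgetPex _ 0 [set A | orthonormal_frame xi A]).
pose B := \matrix_(i < \dim xi) (vbasis xi)`_i.
have memB (x : 'rV[R]_n) : (x \in xi) = (x <= B)%MS.
  apply/idP/submxP => [xxi|[D ->]].
    exists (\row_i coord (vbasis xi) i x).
    rewrite {1}(coord_vbasis xxi) mulmx_sum_row; apply: eq_bigr => i _.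
    by rewrite mxE rowK.
  rewrite mulmx_sum_row memv_suml// => i _; rewrite memvZ// rowK.
  by apply: vbasis_mem; rewrite mem_nth// size_tuple.
have freeB : row_free B.
  rewrite -kermx_eq0; apply/eqP/row_matrixP => i; rewrite row0.
  have /sub_kermxP : (row i (kermx B) <= kermx B)%MS by exact: row_sub.
  move: (row i _) => v; rewrite mulmx_sum_row => vB.
  apply/rowP => j; rewrite mxE.
  have /freeP := basis_free (vbasisP xi); apply.
  by rewrite -[RHS]vB; apply: eq_bigr => l _; rewrite rowK.
have [A A1 AB] := gram_schmidt freeB.
by exists A; split => // x; rewrite AB memB.
Qed.

Definition orthproj (xi : {vspace 'rV[R]_n}) : 'M[R]_n :=
  (frame (\dim xi) xi)^T *m frame (\dim xi) xi.

(* The set of all linear subspaces of R^n, with the sigma-algebra generated by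
   the entries of the matrix of the orthogonal projection onto the subspace.
   On the subspaces of a given dimension this is the Borel sigma-algebra of the
   Grassmann manifold. *)
Definition subspaces : Type := g_sigma_algebra_preimageType orthproj.

HB.instance Definition _ := Measurable.on subspaces.

End linear_subspaces.
Arguments subspaces : clear implicits.

Section grassmannian.
Context {R : realType}.
Variable n : nat.

Definition grassmannian (k : nat) : set (subspaces R n) :=
  [set xi | \dim (xi : {vspace 'rV[R]_n}) = k].

Definition rotation (Q : 'M[R]_n) := Q *m Q^T = 1%:M /\ \det Q = 1.

Definition rotate (Q : 'M[R]_n) (xi : subspaces R n) : subspaces R n :=
  (linfun (mulmxr Q : 'rV[R]_n -> 'rV[R]_n) @: (xi : {vspace 'rV[R]_n}))%VS.

(* The rotation-invariant measure of G_{n,k}, normalized to total mass 1; it is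
   unique because the rotations act transitively on G_{n,k}. *)
Definition grassmann_measure (k : nat) (gamma : probability (subspaces R n) R) :=
  gamma (grassmannian k) = 1%E /\
  forall Q, rotation Q -> forall B, measurable B ->
    gamma (rotate Q @` B) = gamma B.

End grassmannian.

Section funk_transform.
Context {R : realType}.
Variables n k : nat.

(* The isometry v |-> v *m frame k xi of R^k onto xi carries the unit sphere of
   R^k to the unit sphere of xi; by rotation invariance the image of the surface
   measure does not depend on the orthonormal frame. *)
Definition section_measure (xi : subspaces R n) : set 'rV[R]_n -> \bar R :=
  pushforward (@surface_measure R k) (mulmxr (frame k xi)).

Lemma measurable_mulmxr (A : 'M[R]_(k, n)) :
  measurable_fun setT (mulmxr A : 'rV[R]_k -> 'rV[R]_n).
Proof.
apply: measurable_fun_mx => i j; under eq_fun do rewrite mxE.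
apply: measurable_sum => l; apply: measurable_funM; last exact: measurable_cst.
exact: measurable_entry.
Qed.

Let section_measure_measure (xi : subspaces R n) :
    {measure set 'rV[R]_n -> \bar R} :=
  measure_function_pushforward__canonical__measure_function_Measure
    (@surface_measure R k) (measurable_mulmxr (frame k xi)).

HB.instance Definition _ (xi : subspaces R n) :=
  Measure.copy (section_measure xi) (section_measure_measure xi).

Definition section (xi : subspaces R n) : set 'rV[R]_n :=
  [set theta | theta \in (xi : {vspace 'rV[R]_n})].

Definition funk (f : 'rV[R]_n -> R) (xi : subspaces R n) : R :=
  \int[section_measure xi]_(theta in @sphere R n `&` section xi) f theta.

Definition even_on_sphere (f : 'rV[R]_n -> R) :=
  forall theta, sphere theta -> f (- theta) = f theta.

Definition integrable_on_sphere (f : 'rV[R]_n -> R) :=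
  (@surface_measure R n).-integrable (@sphere R n) (EFin \o f).

Variable gamma : probability (subspaces R n) R.

Definition in_funk_range (phi : subspaces R n -> R) :=
  exists g, [/\ even_on_sphere g, integrable_on_sphere g &
    {ae gamma, forall xi, phi xi = funk g xi}].

(* [Finv] is an inverse of the restriction of F_k to even integrable functions,
   everything being taken up to equality almost everywhere. *)
Definition funk_inverse (Finv : (subspaces R n -> R) -> 'rV[R]_n -> R) :=
  forall phi g, even_on_sphere g -> integrable_on_sphere g ->
    {ae gamma, forall xi, phi xi = funk g xi} ->
    {ae @surface_measure R n, forall theta, Finv phi theta = g theta}.

End funk_transform.

Section hemispherical_transforms.
Context {R : realType}.
Variables n k : nat.

Definition hemisphere_pos : set 'rV[R]_n.+1 :=
  [set theta | sphere theta /\ 0 < theta 0 ord_max].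

Definition hemisphere_neg : set 'rV[R]_n.+1 :=
  [set theta | sphere theta /\ theta 0 ord_max < 0].

(* If xi is contained in the orthogonal complement of the last basis vector, the
   domains of integration are empty and the transforms vanish; such xi form a
   null set of the Grassmannian when k <= n. *)
Definition funk_pos (f : 'rV[R]_n.+1 -> R) (xi : subspaces R n.+1) : R :=
  \int[section_measure k xi]_(theta in hemisphere_pos `&` section xi) f theta.

Definition funk_neg (f : 'rV[R]_n.+1 -> R) (xi : subspaces R n.+1) : R :=
  \int[section_measure k xi]_(theta in hemisphere_neg `&` section xi) f theta.

End hemispherical_transforms.

(* Main.v *)
(* Let H be an open hemisphere and let p be f on H and 0 elsewhere. The even
   function g(x) = (p(x) + p(-x)) / 2 equals f/2 on H, and since every section of
   the sphere and its surface measure are invariant under x |-> -x, the integral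
   of g over the section is that of p, i.e. F_k g is the hemispherical transform
   of f for every xi. Hence F_k^-1 of that transform is g, and f = 2 g on H. *)

Require Import Defs.
From mathcomp Require Import all_boot all_order all_algebra.
From mathcomp Require Import all_classical all_reals all_analysis.
From mathcomp Require Import measurable_realfun lra.

Import Order.TTheory GRing.Theory Num.Theory.
Import numFieldNormedType.Exports.

Local Open Scope classical_set_scope.
Local Open Scope ring_scope.

(** * Reflection through the origin and the measures it preserves *)

Lemma preimage_opp_eq (V : zmodType) (A : set V) :
  (forall x, A x -> A (- x)) -> -%R @^-1` A = A.
Proof.
move=> symA; apply/seteqP; split => x /= Ax; last exact: symA.
by rewrite -[x]opprK; exact: symA.
Qed.

Lemma measurable_opp_rV (R : realType) (n : nat) :
  measurable_fun [set: 'rV[R]_n] (-%R : 'rV[R]_n -> 'rV[R]_n).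
Proof.
apply: measurable_fun_mx => i j; under eq_fun do rewrite mxE.
by apply: measurableT_comp => //; exact: measurable_entry.
Qed.

Lemma measurable_preimage_opp_rV (R : realType) (n : nat) (A : set 'rV[R]_n) :
  measurable A -> measurable (-%R @^-1` A).
Proof.
by move=> mA; rewrite -[X in measurable X]setTI; exact: measurable_opp_rV.
Qed.

Definition opp_invariant {R : realType} {n : nat}
    (mu : {measure set 'rV[R]_n -> \bar R}) :=
  forall A : set 'rV[R]_n, measurable A -> mu (-%R @^-1` A) = mu A.

(** A product of sigma-finite measures is determined by its values on rectangles, and (t, v) |->
    (-t, -v) pulls a rectangle back to one whose factors have the same measures. *)
Lemma opp_invariant_lebesgue_step (R : realType) (d : nat)
    (mu : {sigma_finite_measure set 'rV[R]_d -> \bar R}) :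
  opp_invariant mu -> opp_invariant (lebesgue_step mu).
Proof.
move=> muN A mA.
pose opp2 (p : measurableTypeR R * 'rV[R]_d) : measurableTypeR R * 'rV[R]_d :=
  (- p.1, - p.2).
have mopp2 : measurable_fun setT opp2.
  apply/measurable_fun_pairP; split.
    exact: (measurableT_comp (@oppr_measurable R setT) measurable_fst).
  exact: (measurableT_comp (@measurable_opp_rV R d) measurable_snd).
pose m' : {measure set (measurableTypeR R * 'rV[R]_d) -> \bar R} :=
  measure_function_pushforward__canonical__measure_function_Measure
    (@lebesgue_measure R \x mu)%E mopp2.
have mB : measurable (@cons_rV R d @^-1` A).
  by rewrite -[X in measurable X]setTI; exact: measurable_cons_rV.
rewrite /lebesgue_step /= /pushforward.
rewrite [RHS](@product_measure_unique _ _ _ _ _ _ _ m')//; last first.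
  move=> B C mB' mC; rewrite /m' /= /pushforward.
  have -> : opp2 @^-1` (B `*` C) = (-%R @^-1` B) `*` (-%R @^-1` C) by [].
  rewrite product_measure1E//.
  - by congr (_ * _)%E; [exact: (@lebesgue_measureN R B mB')|exact: muN].
  - by rewrite -[X in measurable X]setTI; exact: (@oppr_measurable R setT).
  - exact: measurable_preimage_opp_rV.
rewrite /m' /= /pushforward; congr ((lebesgue_measure \x mu)%E _).
(* It remains that [cons_rV] commutes with negation, checked coordinate by coordinate. *)
apply/funext => p; congr (A _); apply/rowP => j; rewrite !mxE.
by case: unliftP => [?|] _ //=; rewrite mxE.
Qed.

Lemma opp_invariant_lebesgue_rV (R : realType) (d : nat) :
  opp_invariant (lebesgue_rV R d).
Proof.
elim: d => [|d IHd]; last exact: opp_invariant_lebesgue_step.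
(* In dimension 0 the measure is the Dirac mass at 0, a fixed point of the reflection. *)
by move=> A mA /=; rewrite !diracE -{2}oppr0.
Qed.

Lemma enormN (R : realType) (n : nat) (x : 'rV[R]_n) : enorm (- x) = enorm x.
Proof. by congr Num.sqrt; apply: eq_bigr => i _; rewrite mxE sqrrN. Qed.

(** Radial projection commutes with the reflection and the punctured ball is symmetric, so the
    invariance of Lebesgue measure carries over. *)
Lemma opp_invariant_surface (R : realType) (n : nat) :
  opp_invariant (@surface_measure R n).
Proof.
move=> A mA; rewrite /= /surface_measure; congr (_ * _)%E.
rewrite -[RHS]opp_invariant_lebesgue_rV; last first.
  apply: measurableI; last exact: measurable_punctured_ball.
  by rewrite -[X in measurable X]setTI; exact: measurable_sphere_proj.
congr (_ _); apply/funext => x.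
by rewrite /punctured_ball /sphere_proj /setI /= enormN scalerN.
Qed.

(** Multiplication by the frame is linear, so reflection in R^n pulls back to reflection in R^k. *)
Lemma opp_invariant_section (R : realType) (n k : nat) (xi : subspaces R n) :
  opp_invariant (section_measure k xi).
Proof.
move=> A mA; rewrite /= /section_measure /pushforward.
rewrite -[RHS]opp_invariant_surface; last first.
  by rewrite -[X in measurable X]setTI; exact: measurable_mulmxr.
by congr (_ _); apply/funext => x; rewrite /preimage /= mulNmx.
Qed.

(** * Measurability of the sphere and of linear subspaces *)

Lemma measurable_sphere (R : realType) (n : nat) : measurable (@sphere R n).
Proof.
rewrite -[X in measurable X]setTI.
exact: (measurable_enorm measurableT (measurable_set1 1)).
Qed.

Lemma measurable_rV0 (R : realType) (n : nat) : measurable [set 0 : 'rV[R]_n].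
Proof.
have -> : [set 0 : 'rV[R]_n] =
    \bigcap_(j in [set: 'I_n]) [set x : 'rV[R]_n | x 0 j = 0].
  apply/seteqP; split => x /=; first by move=> -> j _ /=; rewrite mxE.
  by move=> x0; apply/rowP => j; rewrite mxE x0.
apply: fin_bigcap_measurable => [|j _]; first exact: finite_finset.
rewrite -[X in measurable X]setTI.
exact: (measurable_entry 0 j measurableT (measurable_set1 0)).
Qed.

(** The subspace is the kernel of the cokernel matrix of its frame, hence the preimage of a
    measurable point under a measurable map. *)
Lemma measurable_section (R : realType) (n : nat) (xi : subspaces R n) :
  measurable (section xi).
Proof.
pose k := \dim (xi : {vspace 'rV[R]_n}).
have [_ memxi] : orthonormal_frame xi (frame k xi) by exact: frameP.
have -> : section xi = mulmxr (cokermx (frame k xi)) @^-1` [set 0].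
  apply/funext => x; rewrite /section /preimage /= memxi submxE.
  by apply/propext; split => /eqP.
rewrite -[X in measurable X]setTI.
exact: (measurable_mulmxr _ measurableT (@measurable_rV0 R n)).
Qed.

Lemma section_opp (R : realType) (n : nat) (xi : subspaces R n) (x : 'rV[R]_n) :
  section xi x -> section xi (- x).
Proof. by rewrite /section /= memvN. Qed.

(** * Even parts and integrals over symmetric domains *)

Definition even_part {V : zmodType} {R : numFieldType} (p : V -> R) (x : V) : R :=
  2^-1 * (p x + p (- x)).

Section symmetric_domain.
Context {R : realType} {n : nat}.
Variables (mu : {measure set 'rV[R]_n -> \bar R}) (D : set 'rV[R]_n).
Hypotheses (muN : opp_invariant mu) (mD : measurable D)
  (DN : forall x, D x -> D (- x)).

Lemma ge0_integral_opp (h : 'rV[R]_n -> \bar R) :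
  measurable_fun setT h -> (forall x, (0 <= h x)%E) ->
  (\int[mu]_(x in D) h (- x)%R = \int[mu]_(x in D) h x)%E.
Proof.
move=> mh h0.
(* Writing [D] as its own preimage puts the left side in the form of the change of variables for an
   image measure. *)
rewrite -{1}(preimage_opp_eq _ _ DN).
rewrite -[LHS](ge0_integral_pushforward (@measurable_opp_rV R n) mu mD)//.
  apply: (eq_measure_integral mu) => [|? A mA _]; last exact: muN.
  exact: measurable_opp_rV.
exact: measurable_funTS.
Qed.

Lemma ge0_integral_even_part (h : 'rV[R]_n -> \bar R) :
  measurable_fun setT h -> (forall x, (0 <= h x)%E) ->
  (\int[mu]_(x in D) ((2^-1)%R%:E * (h x + h (- x)%R)) = \int[mu]_(x in D) h x)%E.
Proof.
move=> mh h0.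
have mhN : measurable_fun setT (fun x : 'rV[R]_n => h (- x)%R).
  exact: (measurableT_comp mh (@measurable_opp_rV R n)).
rewrite ge0_integralZl//; first last.
- by move=> x _; rewrite adde_ge0.
- by apply: measurable_funTS; exact: emeasurable_funD.
rewrite ge0_integralD//; [|exact: measurable_funTS..].
rewrite ge0_integral_opp// -mule2n -mule_natl muleA -EFinM.
by rewrite mulVf ?mul1e// pnatr_eq0.
Qed.

Lemma integrable_opp (p : 'rV[R]_n -> R) : measurable_fun setT p ->
  mu.-integrable D (EFin \o p) -> mu.-integrable D (EFin \o (p \o -%R)).
Proof.
move=> mp /integrableP[_ foo]; apply/integrableP; split.
  apply/measurable_funTS/measurable_EFinP.
  exact: (measurableT_comp mp (@measurable_opp_rV R n)).
rewrite (ge0_integral_opp (fun x => `|(p x)%:E|)%E)//.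
by apply: measurableT_comp => //; exact/measurable_EFinP.
Qed.

Lemma integrable_even_part (p : 'rV[R]_n -> R) : measurable_fun setT p ->
  mu.-integrable D (EFin \o p) -> mu.-integrable D (EFin \o even_part p).
Proof.
move=> mp ip.
have := integrableZl mD 2^-1 (integrableD mD ip (integrable_opp _ mp ip)).
by apply: eq_integrable.
Qed.

(* Integrability is not assumed: since [p x] and [p (- x)] never interact,
   positive and negative parts can be symmetrized separately. *)
Lemma Rintegral_even_part (p : 'rV[R]_n -> R) : measurable_fun setT p ->
  (forall x, p x = 0 \/ p (- x) = 0) ->
  \int[mu]_(x in D) even_part p x = \int[mu]_(x in D) p x.
Proof.
move=> mp p0; rewrite /Rintegral; congr fine.
have mpE : measurable_fun setT (EFin \o p) by exact/measurable_EFinP.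
rewrite integralE [RHS]integralE; congr (_ - _)%E.
- rewrite -[RHS]ge0_integral_even_part//; last exact: measurable_funepos.
  (* As one of [p x] and [p (- x)] is 0, no cancellation occurs and the positive part of the even
     part is the even part of the positive part. *)
  apply: eq_integral => x _; rewrite !funeposE /even_part /= -!EFin_max.
  rewrite -EFinD -EFinM; congr EFin; rewrite !maxEle.
  by case: (p0 x) => ->; do !case: ifPn; rewrite -?ltNge => *; lra.
- rewrite -[RHS]ge0_integral_even_part//; last exact: measurable_funeneg.
  apply: eq_integral => x _; rewrite !funenegE /even_part /= -!EFin_max.
  rewrite -EFinD -EFinM; congr EFin; rewrite !maxEle.
  by case: (p0 x) => ->; do !case: ifPn; rewrite -?ltNge => *; lra.
Qed.

End symmetric_domain.

(** * Symmetrization of a function on a set disjoint from its reflection *)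

(* The integrals over [H `&` section xi] below are convertible to [funk_pos] and
   [funk_neg] when [H] is a hemisphere. *)
Section half_sphere.
Context {R : realType} {n : nat}.
Variables (k : nat) (f : 'rV[R]_n -> R) (H : set 'rV[R]_n).
Hypotheses (intf : integrable_on_sphere f) (mH : measurable H)
  (HS : H `<=` @sphere R n) (HN : forall x, H x -> ~ H (- x)).

Let g : 'rV[R]_n -> R := even_part (f \_ H).

(** Integrability makes [f] measurable on the sphere only; extension by 0 gives the global
    measurability that symmetrization uses. *)
Let measurable_restr : measurable_fun setT (f \_ H).
Proof.
apply/(measurable_restrictT _ mH).
apply: (measurable_funS (@measurable_sphere R n) HS).
by have /integrableP[/measurable_EFinP] := intf.
Qed.

Lemma even_on_sphere_half : even_on_sphere g.
Proof. by move=> x _; rewrite /g /even_part opprK addrC. Qed.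

Lemma integrable_half : integrable_on_sphere g.
Proof.
have mS := @measurable_sphere R n.
apply: integrable_even_part => //.
- exact: opp_invariant_surface.
- by move=> x; rewrite /sphere /= enormN.
- have -> : EFin \o (f \_ H) = (EFin \o f) \_ H.
    by apply/funext => x; rewrite /= !patchE; case: ifP.
  (* Restrict [f] to [H], extend by 0 to the whole space, then restrict to the sphere. *)
  have /(integrable_mkcond _ mH)/(integrableS measurableT mS) :=
    integrableS mS mH HS intf.
  exact.
Qed.

(** The equality holds at every [xi], even where [f] is not integrable on the section. *)
Lemma funk_half xi :
  funk k g xi = \int[section_measure k xi]_(x in H `&` section xi) f x.
Proof.
rewrite /funk Rintegral_even_part//.
- rewrite -Rintegral_mkcondr; congr Rintegral; rewrite setIAC; congr (_ `&` _).
  exact/setIidPr.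
- exact: opp_invariant_section.
- apply: measurableI; first exact: measurable_sphere.
  exact: measurable_section.
- by move=> x [xS xxi]; split; [rewrite /sphere /= enormN|exact: section_opp].
(* [x] and [- x] are never both in [H], so the extension by 0 vanishes at one of them. *)
- move=> x; rewrite !patchE; case: ifPn => [/set_mem Hx|_]; last by left.
  by right; rewrite memNset//; exact: HN.
Qed.

(** On [H] the reflected term vanishes and only the factor 1/2 remains. *)
Lemma half_recover x : H x -> f x = 2 * g x.
Proof.
move=> Hx; rewrite /g /even_part !patchE mem_set// memNset; last exact: HN.
by rewrite addr0 mulrA mulfV ?mul1r// pnatr_eq0.
Qed.

Lemma in_funk_range_half (gamma : probability (subspaces R n) R) :
  in_funk_range k gamma
    (fun xi => \int[section_measure k xi]_(x in H `&` section xi) f x).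
Proof.
exists g; split; [exact: even_on_sphere_half|exact: integrable_half|].
by apply: aeW => xi; rewrite funk_half.
Qed.

Lemma funk_inverse_half (gamma : probability (subspaces R n) R) Finv :
  funk_inverse k gamma Finv ->
  {ae @surface_measure R n, forall x, H x -> f x = 2 * Finv
    (fun xi => \int[section_measure k xi]_(x in H `&` section xi) f x) x}.
Proof.
move=> /(_ _ g even_on_sphere_half integrable_half) => inv.
have /inv : {ae gamma, forall xi,
    \int[section_measure k xi]_(x in H `&` section xi) f x = funk k g xi}.
  by apply: aeW => xi; rewrite funk_half.
by apply: filterS => x Finvx /half_recover; rewrite Finvx.
Qed.

End half_sphere.

(** * The two open hemispheres and the inversion formula *)

Lemma measurable_hemisphere_pos (R : realType) (n : nat) :
  measurable (@hemisphere_pos R n).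
Proof.
have -> : @hemisphere_pos R n =
    @sphere R n.+1 `&` (fun x : 'rV[R]_n.+1 => x 0 ord_max) @^-1` `]0, +oo[.
  by apply/funext => x; rewrite /setI /preimage /= in_itv/= andbT.
apply: measurableI; first exact: measurable_sphere.
rewrite -[X in measurable X]setTI.
exact: (measurable_entry 0 ord_max measurableT (measurable_itv _)).
Qed.

Lemma measurable_hemisphere_neg (R : realType) (n : nat) :
  measurable (@hemisphere_neg R n).
Proof.
have -> : @hemisphere_neg R n =
    @sphere R n.+1 `&` (fun x : 'rV[R]_n.+1 => x 0 ord_max) @^-1` `]-oo, 0[.
  by apply/funext => x; rewrite /setI /preimage /= in_itv.
apply: measurableI; first exact: measurable_sphere.
rewrite -[X in measurable X]setTI.
exact: (measurable_entry 0 ord_max measurableT (measurable_itv _)).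
Qed.

(* The ambient space is R^(n+1), so that the bound on k reads 2 <= k <= n. *)
Theorem theorem2p1 (R : realType) (n k : nat)
    (gamma : probability (subspaces R n.+1) R) (f : 'rV[R]_n.+1 -> R) :
  (2 <= k <= n)%N ->
  grassmann_measure k gamma ->
  integrable_on_sphere f ->
  [/\ in_funk_range k gamma (funk_pos k f),
      in_funk_range k gamma (funk_neg k f) &
      forall Finv : (subspaces R n.+1 -> R) -> 'rV[R]_n.+1 -> R,
        funk_inverse k gamma Finv ->
        {ae @surface_measure R n.+1, forall theta,
          (hemisphere_pos theta -> f theta = 2 * Finv (funk_pos k f) theta) /\
          (hemisphere_neg theta -> f theta = 2 * Finv (funk_neg k f) theta)}].
Proof.
move=> _ _ intf.
have posS : @hemisphere_pos R n `<=` @sphere R n.+1 by move=> x [].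
have negS : @hemisphere_neg R n `<=` @sphere R n.+1 by move=> x [].
have posN (x : 'rV[R]_n.+1) : hemisphere_pos x -> ~ hemisphere_pos (- x).
  by move=> [_ x0] [_]; rewrite mxE oppr_gt0 ltNge (ltW x0).
have negN (x : 'rV[R]_n.+1) : hemisphere_neg x -> ~ hemisphere_neg (- x).
  by move=> [_ x0] [_]; rewrite mxE oppr_lt0 ltNge (ltW x0).
have mpos := @measurable_hemisphere_pos R n.
have mneg := @measurable_hemisphere_neg R n.
split; [exact: in_funk_range_half|exact: in_funk_range_half|].
move=> Finv inv.
have := funk_inverse_half k f _ intf mneg negS negN gamma Finv inv.
have := funk_inverse_half k f _ intf mpos posS posN gamma Finv inv.
by apply: filterS2.
Qed.
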